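(* Let $L>0$, let $f:\mathbb{R}\to\mathbb{R}$ be $f(x)=Lx^2/2$, let $h=1/L$, $\rho>0$, and $x_0\ne 0$. For $\alpha\in[0,1]$ let $(x_k)$ be generated by the constant-$\rho$ $\mathrm{SAM}_\alpha$ iteration $$y_k=x_k+\rho\,\frac{f'(x_k)}{|f'(x_k)|^{\alpha}},\qquad x_{k+1}=x_k-h f'(y_k),$$ and put $s_k=|f'(x_k)|$. (i) If $0<\alpha\le 1$, then for all $k\ge 0$ $$s_{k+1}=L\rho\,s_k^{1-\alpha},$$ and $s_k\to(L\rho)^{1/\alpha}$ as $k\to\infty$. (ii) If $\alpha=0$, then $s_{k+1}=L\rho\,s_k$ for all $k\ge 0$. Thus $s_k\to 0$ if $L\rho<1$, $s_k$ is constant in $k$ if $L\rho=1$, and $s_k\to\infty$ if $L\rho>1$.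
   Context: By convention the method stops at $x_k$ if $f'(x_k)=0$, which removes the undefined normalized direction when $\alpha>0$. *)

(* Defs.v *)
From mathcomp Require Import all_boot all_order all_algebra.
From mathcomp Require Import all_classical all_reals all_analysis.

Set Implicit Arguments.
Unset Strict Implicit.
Unset Printing Implicit Defensive.

Import Order.TTheory GRing.Theory Num.Theory.
Import numFieldNormedType.Exports.

Local Open Scope ring_scope.

(* `^ is powR, for which a `^ 0 = 1 for every a, including a = 0. *)
Definition SAM_perturb (R : realType) (f : R -> R) (rho alpha x : R) : R :=
  x + rho * (derive1 f x / `|derive1 f x| `^ alpha).

Definition SAM_step (R : realType) (f : R -> R) (h rho alpha x : R) : R :=
  x - h * derive1 f (SAM_perturb f rho alpha x).

(* The method stops at a point where f' vanishes; a stopped run is represented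
   by the sequence that stays at that point forever. *)
Fixpoint SAM_iter (R : realType) (f : R -> R) (h rho alpha x0 : R) (k : nat)
    : R :=
  match k with
  | 0%N => x0
  | k'.+1 =>
      let x := SAM_iter f h rho alpha x0 k' in
      if derive1 f x == 0 then x else SAM_step f h rho alpha x
  end.

(* Main.v *)
Require Import Defs.
From mathcomp Require Import all_boot all_order all_algebra.
From mathcomp Require Import all_classical all_reals all_analysis.

Set Implicit Arguments.
Unset Strict Implicit.
Unset Printing Implicit Defensive.

Import Order.TTheory GRing.Theory Num.Theory.
Import numFieldNormedType.Exports.

Local Open Scope classical_set_scope.
Local Open Scope ring_scope.

(** On a quadratic the gradient is linear, f'(x) = L x, so the gradient step of
    size 1/L from the perturbed point y lands at x - y: it undoes the base point
    entirely and leaves only the reversed perturbation,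
    x' = - rho f'(x) / |f'(x)|^alpha ([SAM_step_quadratic]).  Taking absolute
    values gives the scalar recursion s' = a s^(1 - alpha) with a = L rho
    ([SAM_gradient_norm_step]); positivity propagates, so the run never stops.

    The rest is the study of this recursion from s_0 > 0.  For alpha > 0 it has
    the positive fixed point t = a^(1/alpha), and in logarithmic coordinates it
    is affine, ln s' - ln t = (1 - alpha) (ln s - ln t).  Hence
    s_k = t (s_0 / t)^((1 - alpha)^k), where the exponent tends to 0
    ([power_recursion_closed_form], [power_recursion_cvg]).  For alpha = 0 the
    recursion is geometric with ratio a, and the three regimes are those of
    the powers a^k. *)

Lemma cvgr_exprn_pinfty (R : realType) (z : R) :
  1 < z -> z ^+ k @[k --> \oo] --> +oo.
Proof.
move=> z1; have z0 : 0 < z := lt_trans ltr01 z1.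
(* The powers of z diverge because those of its inverse vanish. *)
have /funext VX k : (z ^+ k)^-1 = z^-1 ^+ k by rewrite exprVn.
have cV : (z ^+ k)^-1 @[k --> \oo] --> 0.
  by rewrite VX; apply: cvg_expr; rewrite gtr0_norm ?invr_gt0// invf_lt1.
by apply/gtr0_cvgV0; [apply: nearW => k; rewrite exprn_gt0|exact: cV].
Qed.

Lemma geometric_recursion_closed_form (R : realType) (a : R) (s : nat -> R) :
  (forall k, s k.+1 = a * s k) -> forall k, s k = s 0%N * a ^+ k.
Proof.
move=> sS; elim=> [|k IH]; first by rewrite expr0 mulr1.
by rewrite sS IH exprS mulrCA.
Qed.

(** The point a^(1/alpha) is fixed by s |-> a s^(1 - alpha) because
    a = t^alpha; dividing by it turns the recursion into u' = u^(1 - alpha). *)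
Lemma power_recursion_closed_form (R : realType) (a alpha : R) (s : nat -> R)
    (t := a `^ (1 / alpha)) :
  0 < a -> 0 < alpha -> 0 < s 0%N ->
  (forall k, s k.+1 = a * s k `^ (1 - alpha)) ->
  forall k, s k = t * (s 0%N / t) `^ ((1 - alpha) ^+ k).
Proof.
move=> a0 al0 s0 sS; have t0 : 0 < t by exact: powR_gt0.
have u0 : 0 <= s 0%N / t by rewrite divr_ge0// ltW.
have at_ : a = t `^ alpha.
  by rewrite /t -powRrM divrK ?unitfE ?gt_eqF// powRr1// ltW.
elim=> [|k IH]; first by rewrite expr0 powRr1// mulrC divfK// gt_eqF.
rewrite sS IH powRM ?powR_ge0 1?ltW// -powRrM -exprSr mulrA; congr (_ * _).
rewrite {1}at_ -powRD; last by apply/implyP => _; rewrite gt_eqF.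
by rewrite addrC subrK powRr1// ltW.
Qed.

(** The closed form has an exponent that tends to 0; for alpha = 1 this still
    holds, since 0^k vanishes from k = 1 on. *)
Lemma power_recursion_cvg (R : realType) (a alpha : R) (s : nat -> R) :
  0 < a -> 0 < alpha -> alpha <= 1 -> 0 < s 0%N ->
  (forall k, s k.+1 = a * s k `^ (1 - alpha)) ->
  s @ \oo --> a `^ (1 / alpha).
Proof.
move=> a0 al0 al1 s0 sS; set t := a `^ (1 / alpha).
have t0 : 0 < t by exact: powR_gt0.
have -> : s = fun k => t * expR ((1 - alpha) ^+ k * ln (s 0%N / t)).
  apply/funext => k.
  rewrite {1}(power_recursion_closed_form a0 al0 s0 sS k) -/t /powR.
  by rewrite gt_eqF// divr_gt0.
have tE : t = t * expR (0 * ln (s 0%N / t)) by rewrite mul0r expR0 mulr1.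
rewrite [X in _ --> X]tE; apply: cvgMl_tmp.
apply: continuous_cvg; first exact: continuous_expR.
apply: cvgMr_tmp; apply: cvg_expr.
by rewrite ger0_norm ?subr_ge0// gtrDl oppr_lt0.
Qed.

Lemma derive1_quadratic (R : realType) (L x : R) :
  derive1 (fun x : R => L * x ^+ 2 / 2) x = L * x.
Proof.
have -> : (fun x : R => L * x ^+ 2 / 2) = (L / 2) \*: (@GRing.exp R ^~ 2).
  by apply/funext => y; rewrite /= /GRing.scale/= mulrAC.
rewrite derive1E deriveZ//= exp_derive /GRing.scale/= expr1 mulr1 mulrA.
by rewrite -[_ *+ 2]mulr_natr divfK// pnatr_eq0.
Qed.

(** The step size is the inverse of the curvature, so the minimizer 0 would be
    reached at once from an unperturbed point; only the perturbation remains. *)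
Lemma SAM_step_quadratic (R : realType) (L rho alpha x : R) : L != 0 ->
  SAM_step (fun x => L * x ^+ 2 / 2) (1 / L) rho alpha x =
  - (rho * (L * x / `|L * x| `^ alpha)).
Proof.
move=> L0; rewrite /SAM_step /SAM_perturb !derive1_quadratic.
by rewrite mulrA div1r mulVf// mul1r opprD addNKr.
Qed.

Lemma SAM_gradient_norm_step (R : realType) (L rho alpha x : R) :
  0 < L -> 0 < rho -> x != 0 ->
  `|L * SAM_step (fun x => L * x ^+ 2 / 2) (1 / L) rho alpha x| =
  L * rho * `|L * x| `^ (1 - alpha).
Proof.
move=> L0 r0 x0; have g0 : 0 < `|L * x| by rewrite normr_gt0 mulf_neq0// gt_eqF.
rewrite SAM_step_quadratic ?gt_eqF// mulrN normrN (mulrA L rho) [LHS]normrM.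
rewrite (gtr0_norm (mulr_gt0 L0 r0)); congr (_ * _).
rewrite normf_div (ger0_norm (powR_ge0 _ _)).
by rewrite powRB ?powRr1//; apply/implyP => _; rewrite gt_eqF.
Qed.

Theorem theorem7 (R : realType) (L : R) (f : R -> R) (h rho x0 alpha : R)
    (hL : 0 < L) (hf : f = (fun x => L * x ^+ 2 / 2)) (hh : h = 1 / L)
    (hrho : 0 < rho) (hx0 : x0 != 0) (halpha : 0 <= alpha <= 1) :
  let x : nat -> R := SAM_iter f h rho alpha x0 in
  let s : nat -> R := fun k => `|derive1 f (x k)| in
  (forall k, derive1 f (x k) != 0) /\
  (0 < alpha ->
     (forall k, s k.+1 = L * rho * s k `^ (1 - alpha)) /\
     s @ \oo --> (L * rho) `^ (1 / alpha)) /\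
  (alpha = 0 ->
     (forall k, s k.+1 = L * rho * s k) /\
     (L * rho < 1 -> s @ \oo --> 0) /\
     (L * rho = 1 -> forall j k, s j = s k) /\
     (1 < L * rho -> s @ \oo --> +oo)).
Proof.
subst f h => x s.
have a0 : 0 < L * rho by rewrite mulr_gt0.
have sE k : s k = `|L * x k| by rewrite /s derive1_quadratic.
have gne k : x k != 0 -> derive1 (fun x : R => L * x ^+ 2 / 2) (x k) != 0.
  by move=> xk0; rewrite derive1_quadratic mulf_neq0// gt_eqF.
have sS k : x k != 0 -> s k.+1 = L * rho * s k `^ (1 - alpha).
  move=> xk0; rewrite !sE -SAM_gradient_norm_step//.
  by congr `|L * _|; exact: ifN (gne k xk0).
have xne k : x k != 0.
  elim: k => // k xk0.
  suff : 0 < s k.+1 by rewrite sE normr_gt0 mulf_eq0 negb_or => /andP[].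
  by rewrite sS// mulr_gt0// powR_gt0// sE normr_gt0 mulf_neq0// gt_eqF.
have s0 : 0 < s 0%N by rewrite sE normr_gt0 mulf_neq0// gt_eqF.
split; first by move=> k; exact/gne/xne.
split=> [al0|al0].
  split=> [k|]; first exact: sS.
  by apply: power_recursion_cvg => //; [case/andP: halpha|move=> k; exact: sS].
have sSl k : s k.+1 = L * rho * s k.
  by rewrite sS// al0 subr0 powRr1// sE.
have sC := geometric_recursion_closed_form sSl.
split=> //; split=> [a1|]; last split=> [a1 j k|a1].
- rewrite (funext sC); apply: (@cvg_geometric R (s 0%N)).
  by rewrite gtr0_norm.
- by rewrite sC [RHS]sC a1 !expr1n.
- rewrite (funext sC); have sM : s 0%N * r @[r --> +oo] --> +oo by exact: gt0_cvgMry.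
  exact: cvg_comp _ _ (cvgr_exprn_pinfty a1) sM.
Qed.
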